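(* Let $c^0=(c_i^0)_{i\ge 1}\in B^+$ and let $\phi=(\phi_{i,j})_{i,j\ge1}$ be a non-negative symmetric kernel satisfying one of the following three conditions: (1) $\phi_{i,j}\le \frac{i+j}{\min\{i,j\}}$ for all $i,j\in\mathbb{N}$; (2) $\phi_{i,j}\le i+j$ for all $i,j\in\mathbb{N}$; (3) $\phi_{i,j}\le (1+i+j)^{\alpha}$ for all $i,j\in\mathbb{N}$, for some $\alpha\in[0,1]$. Suppose that, for each $n\ge 2$, $(c_i^n(t))_{1\le i\le n}$ is the solution of the non-conservative truncated system with initial condition $c_i^n(0)=c_i^0$, $1\le i\le n$. Then there exists a solution $c=(c_i)_{i\ge1}$ of the Safronov-Dubovski (discrete Oort-Hulst-Safronov) initial value problem with initial datum $c^0$ on $[0,\infty)$, i.e. a solution in the sense of the definition given in the context with $T=\infty$.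
   Context: Here $\mathbb{N}=\{1,2,\dots\}$. The Safronov-Dubovski initial value problem is $$\frac{dc_i(t)}{dt}=c_{i-1}(t)\sum_{j=1}^{i-1}j\phi_{i-1,j}c_j(t)-c_i(t)\sum_{j=1}^{i}j\phi_{i,j}c_j(t)-\sum_{j=i}^{\infty}\phi_{i,j}c_i(t)c_j(t),\quad i\ge1,\ t\ge 0,$$ with $c_i(0)=c_i^0\ge0$, where the first term is absent for $i=1$. The kernel satisfies $\phi_{i,j}\ge0$ and $\phi_{i,j}=\phi_{j,i}$. Spaces: $B=\{z=(z_d)_{d\ge1}:\|z\|<\infty\}$ with $\|z\|=\sum_{d=1}^\infty d|z_d|$, and $B^+=\{c=(c_i)\in B: c_i\ge0 \text{ for all } i\}$. Definition of solution: let $T\in(0,\infty]$. A solution of the initial value problem on $[0,T)$ is a function $c=(c_i):[0,T)\to B^+$ such that: 1. every $c_i$ is continuous and $\sup_{0\le t<T}\|c(t)\|<\infty$; 2. $\int_0^t\sum_{j=1}^\infty\phi_{i,j}c_j(h)\,dh<\infty$ for every $i$ and every $0\le t<T$; 3. for every $i$ and every $0\le t<T$, $$c_i(t)=c_i(0)+\int_0^t\Bigl(\delta_{i\ge2}\,c_{i-1}(h)\sum_{j=1}^{i-1}j\phi_{i-1,j}c_j(h)-c_i(h)\sum_{j=1}^{i}j\phi_{i,j}c_j(h)-c_i(h)\sum_{j=i}^\infty\phi_{i,j}c_j(h)\Bigr)dh,$$ with $c_i(0)=c_i^0$, where $\delta_P=1$ if $P$ is true and $0$ otherwise. Non-conservative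 truncated system (for $n\ge2$): $\frac{dc_i^n}{dt}=C_i^n(c^n)$, $1\le i\le n$, where $$C_1^n(c)=-\phi_{1,1}c_1^2-c_1\sum_{j=1}^n\phi_{1,j}c_j,$$ $$C_i^n(c)=c_{i-1}\sum_{j=1}^{i-1}j\phi_{i-1,j}c_j-c_i\sum_{j=1}^{i}j\phi_{i,j}c_j-c_i\sum_{j=i}^n\phi_{i,j}c_j\quad(2\le i\le n-1),$$ $$C_n^n(c)=c_{n-1}\sum_{j=1}^{n-1}j\phi_{n-1,j}c_j.$$ Only non-negative solutions are considered. *)

(* Defs.v *)
From HB Require Import structures.
From mathcomp Require Import all_boot all_order all_algebra.
From mathcomp Require Import all_classical all_reals all_analysis.
Set Implicit Arguments.
Unset Strict Implicit.
Unset Printing Implicit Defensive.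
Import Order.TTheory GRing.Theory Num.Theory.
Import numFieldNormedType.Exports.
Local Open Scope classical_set_scope.
Local Open Scope ring_scope.

(* Sequences (z_d)_{d >= 1} are functions nat -> R, and kernels
   (phi_{i,j})_{i,j >= 1} are functions nat -> nat -> R; values at index 0 are
   junk and never constrained. A family (c_i(t)) is a function c : R -> nat -> R
   with c t i = c_i(t); its values at times outside the interval considered are
   junk as well. *)

Definition normB (R : realType) (z : nat -> R) : \bar R :=
  (\sum_(1 <= d <oo) (d%:R * `|z d|)%:E)%E.

Definition Bplus (R : realType) : set (nat -> R) :=
  [set z | (normB z < +oo)%E /\ forall i : nat, (1 <= i)%N -> 0 <= z i].

Definition kernel_nonneg (R : realType) (phi : nat -> nat -> R) : Prop :=
  forall i j : nat, (1 <= i)%N -> (1 <= j)%N -> 0 <= phi i j.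

Definition kernel_sym (R : realType) (phi : nat -> nat -> R) : Prop :=
  forall i j : nat, (1 <= i)%N -> (1 <= j)%N -> phi i j = phi j i.

(* The term delta_{i>=2} z_{i-1} sum_{j=1}^{i-1} j phi_{i-1,j} z_j. *)
Definition gain (R : realType) (phi : nat -> nat -> R) (z : nat -> R)
    (i : nat) : R :=
  (2 <= i)%N%:R * (z i.-1 * \sum_(1 <= j < i) j%:R * phi i.-1 j * z j).

(* The term z_i sum_{j=1}^{i} j phi_{i,j} z_j. *)
Definition loss (R : realType) (phi : nat -> nat -> R) (z : nat -> R)
    (i : nat) : R :=
  z i * \sum_(1 <= j < i.+1) j%:R * phi i j * z j.

Definition time_dom (R : realType) (T : \bar R) : set R :=
  [set t | 0 <= t /\ (t%:E < T)%E].

(* The integrals are Lebesgue integrals of extended-real functions: the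
   infinite sums may take the value +oo, but the summability clause makes them
   finite almost everywhere on [0, t]. In the last clause only the last of the
   three terms can be infinite, so no indeterminate difference occurs. *)
Record is_solution (R : realType) (phi : nat -> nat -> R) (c0 : nat -> R)
    (T : \bar R) (c : R -> nat -> R) : Prop := IsSolution {
  sol_Bplus : forall t : R, time_dom T t -> Bplus (c t);
  sol_continuous : forall i : nat, (1 <= i)%N ->
    {within time_dom T, continuous (fun t : R => c t i)};
  sol_bounded : (ereal_sup [set normB (c t) | t in time_dom T] < +oo)%E;
  sol_summable : forall (i : nat) (t : R), (1 <= i)%N -> time_dom T t ->
    (\int[@lebesgue_measure R]_(h in `[0%R, t])
       (\sum_(1 <= j <oo) (phi i j * c h j)%:E) < +oo)%E;
  sol_init : forall i : nat, (1 <= i)%N -> c 0 i = c0 i;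
  sol_integral_eq : forall (i : nat) (t : R), (1 <= i)%N -> time_dom T t ->
    ((c t i)%:E = (c 0%R i)%:E +
       \int[@lebesgue_measure R]_(h in `[0%R, t])
         ((gain phi (c h) i)%:E - (loss phi (c h) i)%:E
          - (c h i)%:E * \sum_(i <= j <oo) (phi i j * c h j)%:E))%E
}.

Definition trunc_rhs (R : realType) (n : nat) (phi : nat -> nat -> R)
    (z : nat -> R) (i : nat) : R :=
  if i == 1%N then
    - (phi 1%N 1%N * z 1%N ^+ 2)
    - z 1%N * \sum_(1 <= j < n.+1) phi 1%N j * z j
  else if i == n then
    gain phi z n
  else
    gain phi z i - loss phi z i - z i * \sum_(i <= j < n.+1) phi i j * z j.

(* l is the derivative at t of f seen as a function on D; at an endpoint of an
   interval D this is the one-sided derivative. *)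
Definition is_derive_within (R : realType) (D : set R) (f : R -> R)
    (t l : R) : Prop :=
  (f s - f t) / (s - t) @[s --> within D t^'] --> l.

(* Classical non-negative solutions on [0, oo); only the components
   1 <= i <= n are constrained (and used by trunc_rhs n). *)
Record is_trunc_solution (R : realType) (n : nat) (phi : nat -> nat -> R)
    (c0 : nat -> R) (c : R -> nat -> R) : Prop := IsTruncSolution {
  trunc_nonneg : forall (i : nat) (t : R), (1 <= i <= n)%N -> 0 <= t ->
    0 <= c t i;
  trunc_init : forall i : nat, (1 <= i <= n)%N -> c 0 i = c0 i;
  trunc_ode : forall (i : nat) (t : R), (1 <= i <= n)%N -> 0 <= t ->
    is_derive_within [set s | 0 <= s] (fun s : R => c s i) t
      (trunc_rhs n phi (c t) i)
}.

Definition kernel_bound1 (R : realType) (phi : nat -> nat -> R) : Prop :=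
  forall i j : nat, (1 <= i)%N -> (1 <= j)%N ->
    phi i j <= (i + j)%:R / (minn i j)%:R.

Definition kernel_bound2 (R : realType) (phi : nat -> nat -> R) : Prop :=
  forall i j : nat, (1 <= i)%N -> (1 <= j)%N -> phi i j <= (i + j)%:R.

Definition kernel_bound3 (R : realType) (phi : nat -> nat -> R) : Prop :=
  exists alpha : R, 0 <= alpha <= 1 /\
    forall i j : nat, (1 <= i)%N -> (1 <= j)%N ->
      phi i j <= (1 + i + j)%:R `^ alpha.

(* Main.v *)
Require Import Defs.
From HB Require Import structures.
From mathcomp Require Import all_boot all_order all_algebra.
From mathcomp Require Import all_classical all_reals all_analysis.
From mathcomp Require Import measurable_realfun ring lra.
Set Implicit Arguments.
Unset Strict Implicit.
Unset Printing Implicit Defensive.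
Import Order.TTheory GRing.Theory Num.Theory.
Import numFieldNormedType.Exports.
Local Open Scope classical_set_scope.
Local Open Scope ring_scope.

(* Each of the three conditions gives phi_{i,j} <= 2 (i + j), and only this
   bound matters. For the truncated system, testing with the weights i shows
   that the mass is nonincreasing, and testing with i min(i/N, 1) gives, by
   Gronwall, a bound on the mass carried by the sizes >= N that is uniform in
   the truncation and in bounded times, and small for N large. Coordinates are
   Lipschitz in time uniformly in the truncation. Taking limits along an
   ultrafilter on the truncation index (instead of extracting a diagonal
   subsequence), the tail bound makes the right-hand sides converge jointly in
   (truncation, time), so that the mean value theorem survives in the limit:
   the limit is C^1 with the expected derivative, and the integral equation is
   the fundamental theorem of calculus. *)

(** * One-sided derivatives on the half-line *)

Lemma near_dist_lt (R : realType) (s d : R) : 0 < d ->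
  \forall u \near s, `|u - s| < d.
Proof.
move=> d0; apply/nbhs_ballP; exists d => //= u.
by rewrite /ball/= distrC.
Qed.

(** Clearing the denominator makes the estimate trivial at [s = t], and a non-strict inequality
    survives pointwise limits of [f]. *)
Lemma is_derive_withinP (R : realType) (f : R -> R) (t l : R) :
  is_derive_within [set s | 0 <= s] f t l <->
  forall e, 0 < e -> \forall s \near t, 0 <= s ->
    `|f s - f t - l * (s - t)| <= e * `|s - t|.
Proof.
have quotE s : s != t ->
    `|f s - f t - l * (s - t)| = `|l - (f s - f t) / (s - t)| * `|s - t|.
  rewrite -subr_eq0 => st0; rewrite -normrM mulrBl divfK// -normrN.
  by congr `|_|; ring.
have dpos s : s != t -> 0 < `|s - t| by rewrite normr_gt0 subr_eq0.
split=> [/cvgrPdist_le fl e e0|fl].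
- have : \forall s \near t, s != t -> 0 <= s ->
    `|l - (f s - f t) / (s - t)| <= e by exact: fl.
  apply: filterS => s fs s0; have [->|st] := eqVneq s t.
    by rewrite !subrr mulr0 subrr normr0 mulr0.
  by rewrite quotE// ler_pM2r ?dpos//; exact: fs.
- apply/cvgrPdist_le => e e0.
  have : \forall s \near t, s != t -> 0 <= s ->
    `|l - (f s - f t) / (s - t)| <= e.
    apply: filterS (fl e e0) => s fs st s0.
    by rewrite -(ler_pM2r (dpos _ st)) -quotE//; exact: fs.
  by [].
Qed.

Lemma is_derive_within_continuous (R : realType) (f : R -> R) (t l : R) :
  is_derive_within [set s | 0 <= s] f t l ->
  f s @[s --> within [set s | 0 <= s] (nbhs t)] --> f t.
Proof.
move=> /is_derive_withinP fl; apply/cvgrPdist_le => e e0.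
have L0 : 0 < `|l| + 1 by rewrite ltr_pwDr.
have : \forall s \near t, 0 <= s -> `|f t - f s| <= e.
  near=> s => s0.
  have st : `|s - t| <= e / (`|l| + 1).
    by apply: ltW; near: s; apply: near_dist_lt; rewrite divr_gt0.
  have fs : `|f s - f t - l * (s - t)| <= 1 * `|s - t|.
    by move: s0; near: s; exact: fl.
  rewrite distrC -(subrK (l * (s - t)) (f s - f t)).
  rewrite (le_trans (ler_normD _ _))// (le_trans (lerD fs (lexx _)))//.
  by rewrite normrM -mulrDl addrC mulrC -ler_pdivlMr.
by [].
Unshelve. all: by end_near. Qed.

(** Near a point t > 0 the constraint [0 <= s] is automatic, which opens the way to the two-sided
    calculus theorems. *)
Lemma is_derive_within_interior (R : realType) (f : R -> R) (t l : R) :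
  0 < t -> is_derive_within [set s | 0 <= s] f t l -> is_derive t 1 f l.
Proof.
move=> t0 /is_derive_withinP fl.
have H : h^-1 *: (f (h *: 1 + t) - f t) @[h --> 0^'] --> l.
  apply/cvgrPdist_le => e e0.
  have := fl e e0; rewrite (near_shift 0 t)/= => {}fl.
  have : \forall h \near 0, h != 0 ->
      `|l - h^-1 *: (f (h *: 1 + t) - f t)| <= e.
    near=> h => h0.
    have hp : 0 < `|h| by rewrite normr_gt0.
    rewrite -(ler_pM2r hp) -normrM -normrN.
    have : `|f (h + t) - f t - l * (h + t - t)| <= e * `|h + t - t|.
      have : 0 <= h + t.
        by near: h; apply: (@cvgr_ge _ _ _ _ (fun h : R => h + t) (0 + t));
          [apply: cvgD; [exact: cvg_id|exact: cvg_cst]|rewrite add0r].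
      by near: h; move: fl; rewrite subr0.
    rewrite addrK; suff -> : f (h + t) - f t - l * h =
      - ((l - h^-1 *: (f (h *: 1 + t) - f t)) * h) by [].
    by rewrite /= /GRing.scale /= mulr1; field.
  by [].
split; first by apply/cvg_ex; exists l.
exact/cvg_lim.
Unshelve. all: by end_near. Qed.

(** Interior points are positive, so derivatives are two-sided there; at the left endpoint, possibly
    0, only continuity is required. *)
Lemma MVT_within (R : realType) (f df : R -> R) (s t : R) :
  (forall u, 0 <= u -> is_derive_within [set s | 0 <= s] f u (df u)) ->
  0 <= s -> s < t ->
  exists2 u, s < u < t & f t - f s = df u * (t - s).
Proof.
move=> fdf s0 st.
have [||u ust ->] := @MVT R f df s t st; last by exists u.
- move=> u; rewrite in_itv/= => /andP[su _].
  by apply: is_derive_within_interior; [exact: le_lt_trans su|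
    exact/fdf/(le_trans s0)/ltW].
- apply/subspace_continuousP => u /=; rewrite in_itv/= => /andP[su ut].
  have := is_derive_within_continuous (fdf u (le_trans s0 su)).
  apply: cvg_trans; apply: cvg_app; apply: within_subset => v /=.
  by rewrite in_itv/= => /andP[/(le_trans s0)].
Qed.

(** The derivative of f(u) exp(-L u) is nonpositive, so the mean value theorem compares its values
    at t and at 0. The case [L = 0] gives monotonicity. *)
Lemma gronwall_within (R : realType) (f df : R -> R) (L t : R) :
  (forall u, 0 <= u -> is_derive_within [set s | 0 <= s] f u (df u)) ->
  (forall u, 0 <= u -> df u <= L * f u) ->
  0 <= t -> f t <= expR (L * t) * f 0.
Proof.
move=> fdf dfL; rewrite le_eqVlt => /predU1P[<-|t0].
  by rewrite mulr0 expR0 mul1r.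
pose h u := f u * expR (- L * u).
pose dh u := (df u - L * f u) * expR (- L * u).
have hE (u : R) :
    is_derive u (1 : R) (fun v : R => expR (- L * v)) (- L * expR (- L * u)).
  have -> : (fun v : R => expR (- L * v)) = expR \o ( *%R (- L)) by [].
  have lin : is_derive u (1 : R) ( *%R (- L)) (- L).
    have := is_deriveZ (- L) (is_derive_id u (1 : R)).
    by rewrite /GRing.scale/= mulr1.
  have := is_derive1_comp (is_derive_expR (- L * u)) lin.
  by rewrite mulrC.
have [||u ut hdh] := @MVT R h dh 0 t t0.
- move=> u; rewrite in_itv/= => /andP[u0 _].
  have fu := is_derive_within_interior u0 (fdf u (ltW u0)).
  have -> : h = f * (fun u => expR (- L * u)) by [].
  by apply: is_derive_eq; rewrite /GRing.scale/= /dh; ring.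
- apply/subspace_continuousP => u /=; rewrite in_itv/= => /andP[u0 ut].
  apply: cvgM.
    have := is_derive_within_continuous (fdf u u0).
    apply: cvg_trans; apply: cvg_app; apply: within_subset => v /=.
    by rewrite in_itv/= => /andP[].
  apply: cvg_within_filter; 
  apply: (@continuous_comp _ _ _ ( *%R (- L)) expR u).
    exact: mulrl_continuous.
  exact: continuous_expR.
move: ut; rewrite in_itv/= => /andP[/ltW u0 _].
have : h t - h 0 <= 0.
  rewrite hdh subr0 mulr_le0_ge0 ?(ltW t0)// mulr_le0_ge0 ?expR_ge0//.
  by rewrite subr_le0; exact: dfL.
rewrite subr_le0 /h mulr0 expR0 mulr1 => ht.
rewrite -(ler_pM2l (expR_gt0 (- L * t))) mulrA -expRD mulNr addNr expR0 mul1r.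
by rewrite mulrC -mulNr.
Qed.

Lemma is_derive_within_sum (R : realType) (D : set R) (I : Type) (r : seq I)
    (P : pred I) (g : I -> R) (f : I -> R -> R) (t : R) (l : I -> R) :
  (forall i, P i -> is_derive_within D (f i) t (l i)) ->
  is_derive_within D (fun s => \sum_(i <- r | P i) g i * f i s) t
    (\sum_(i <- r | P i) g i * l i).
Proof.
move=> fl; rewrite /is_derive_within.
rewrite [X in X @ _ --> _](_ : _ = fun s =>
    \sum_(i <- r | P i) g i * ((f i s - f i t) / (s - t))); last first.
  apply/funext => s; rewrite -sumrB mulr_suml; apply: eq_bigr => i _.
  by rewrite -mulrBr mulrA.
apply: cvg_big => [|i Pi]; first exact: add_continuous.
by apply: cvgM; [exact: cvg_cst|exact: fl].
Qed.

(** * Moments of the truncated system *)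

(** The right-hand side common to all sizes below the last one. The bound [n] is exclusive: the
    truncation of size [n] corresponds to [n.+1]. *)
Definition flow (R : realType) (phi : nat -> nat -> R) (z : nat -> R)
    (n i : nat) : R :=
  gain phi z i - loss phi z i - z i * \sum_(i <= j < n) phi i j * z j.

(** Bounding real partial sums lets the condition pass to pointwise limits. The sign is imposed at
    the junk index 0 as well, so the families built below are set to 0 there. *)
Definition mass_le (R : realType) (M : R) (z : nat -> R) : Prop :=
  (forall i, 0 <= z i) /\ forall n, \sum_(1 <= i < n) i%:R * z i <= M.

Definition kernel_linear (R : realType) (phi : nat -> nat -> R) : Prop :=
  forall i j : nat, (1 <= i)%N -> (1 <= j)%N -> phi i j <= 2 * (i + j)%:R.

(** The factor 2 comes from the third condition: (1+i+j)^alpha <= 1+i+j <= 2(i+j). *)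
Lemma kernel_bounds_linear (R : realType) (phi : nat -> nat -> R) :
  kernel_bound1 phi \/ kernel_bound2 phi \/ kernel_bound3 phi ->
  kernel_linear phi.
Proof.
move=> H i j i1 j1; have ij0 : (0 : R) <= (i + j)%:R by rewrite ler0n.
case: H => [H|[H|[a [/andP[_ a1] H]]]].
- apply: le_trans (H _ _ i1 j1) _.
  have m1 : (1 : R) <= (minn i j)%:R by rewrite ler1n leq_min i1.
  rewrite ler_pdivrMr ?(lt_le_trans ltr01)//.
  by rewrite -mulrA mulrCA ler_peMr//; lra.
- by apply: le_trans (H _ _ i1 j1) _; lra.
- apply: le_trans (H _ _ i1 j1) _.
  apply: (@le_trans _ _ ((1 + i + j)%:R `^ 1)).
    by rewrite ler_powR// ler1n -addnA.
  rewrite powRr1 ?ler0n// -natrM ler_nat -addnA mul2n -addnn leq_add2r.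
  by rewrite (leq_trans i1)// leq_addr.
Qed.

(** The larger index is i in the loss sum and the summation index in the coagulation sum; bounding
    the kernel by it alone lets the first moment control both. *)
Lemma kernel_linear_le (R : realType) (phi : nat -> nat -> R) (i j : nat) :
  kernel_linear phi -> (1 <= j <= i)%N -> phi i j <= 4 * i%:R.
Proof.
move=> H /andP[j1 ji]; apply: le_trans (H _ _ (leq_trans j1 ji) j1) _.
rewrite -!natrM ler_nat (_ : 4 = 2 * 2)%N// -mulnA leq_mul2l/=.
by rewrite mul2n -addnn leq_add2l.
Qed.

Lemma gain1 (R : realType) (phi : nat -> nat -> R) (z : nat -> R) :
  gain phi z 1 = 0.
Proof. by rewrite /gain mul0r. Qed.

(** This makes moments telescope and reduces gain estimates to loss estimates. *)
Lemma gainS (R : realType) (phi : nat -> nat -> R) (z : nat -> R) (i : nat) :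
  (1 <= i)%N -> gain phi z i.+1 = loss phi z i.
Proof. by rewrite /gain /loss ltnS => ->; rewrite mul1r. Qed.

Section mass_bounds.
Context (R : realType) (phi : nat -> nat -> R) (M : R) (z : nat -> R).
Hypotheses (phi0 : kernel_nonneg phi) (phiS : kernel_sym phi).
Hypotheses (phiL : kernel_linear phi) (zM : mass_le M z).

Lemma mass_ge0 : 0 <= M.
Proof. by case: zM => _ /(_ 1%N); rewrite big_geq. Qed.

Lemma mass_le_coord (i : nat) : (1 <= i)%N -> z i <= M.
Proof.
move=> i1; have [z0 /(_ i.+1)] := zM; apply: le_trans.
rewrite big_nat_recr//= ler_wpDl//.
  by apply: sumr_ge0 => j _; rewrite mulr_ge0.
by rewrite ler_peMl// ler1n.
Qed.

Lemma loss_ge0 (i : nat) : (1 <= i)%N -> 0 <= loss phi z i.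
Proof.
move=> i1; have [z0 _] := zM; rewrite mulr_ge0// big_nat sumr_ge0// => j.
by case/andP=> j1 _; rewrite !mulr_ge0// phi0.
Qed.

Lemma loss_le (i : nat) : (1 <= i)%N -> loss phi z i <= 4 * M * (i%:R * z i).
Proof.
move=> i1; have [z0 zs] := zM.
rewrite /loss [leRHS](_ : _ = z i * (4 * i%:R * M)); last by ring.
rewrite ler_wpM2l//.
apply: (@le_trans _ _ (\sum_(1 <= j < i.+1) 4 * i%:R * (j%:R * z j))).
  rewrite !big_nat; apply: ler_sum => j /andP[j1 ji].
  rewrite mulrAC mulrC ler_wpM2r// ?mulr_ge0//.
  by apply: kernel_linear_le => //; rewrite j1.
by rewrite -mulr_sumr ler_wpM2l ?mulr_ge0.
Qed.

(** For j >= m >= i the kernel is at most 4 j, so small mass tails make the coagulation tails small,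
    with no dependence on i. *)
Lemma coag_sum_le (i m n : nat) (e : R) : (1 <= i <= m)%N ->
  \sum_(m <= j < n) j%:R * z j <= e ->
  0 <= \sum_(m <= j < n) phi i j * z j <= 4 * e.
Proof.
move=> /andP[i1 im] ze; have [z0 _] := zM; apply/andP; split.
  rewrite big_nat sumr_ge0// => j /andP[mj _].
  by rewrite mulr_ge0// phi0// (leq_trans i1)// (leq_trans im).
apply: (@le_trans _ _ (\sum_(m <= j < n) 4 * (j%:R * z j))).
  rewrite !big_nat; apply: ler_sum => j /andP[mj _].
  have ij := leq_trans im mj.
  rewrite mulrA ler_wpM2r// phiS ?(leq_trans i1)//.
  by apply: kernel_linear_le => //; rewrite i1.
by rewrite -mulr_sumr ler_wpM2l.
Qed.

Lemma mass_le_tail (m n : nat) : (1 <= m)%N ->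
  \sum_(m <= j < n) j%:R * z j <= M.
Proof.
move=> m1; have [z0 zs] := zM; have [nm|/ltnW mn] := leqP n m.
  by rewrite big_geq// mass_ge0.
apply: le_trans (zs n); rewrite [leRHS](big_cat_nat m1 mn)/= ler_wpDl//.
by rewrite sumr_ge0// => j _; rewrite mulr_ge0.
Qed.

(** Gain, loss and coagulation each lie between 0 and 4 i M^2. The bound serves as a Lipschitz
    constant in time, independent of the truncation. *)
Lemma flow_bound (n i : nat) : (1 <= i)%N ->
  `|flow phi z n i| <= 12 * i%:R * M ^+ 2.
Proof.
move=> i1; have M0 := mass_ge0; have [z0 _] := zM.
have L k : (1 <= k)%N -> 0 <= loss phi z k <= 4 * k%:R * M ^+ 2.
  move=> k1; rewrite loss_ge0//= (le_trans (loss_le k1))//.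
  rewrite expr2 -!mulrA ler_wpM2l// mulrCA !ler_wpM2l//.
  exact: mass_le_coord.
have G : 0 <= gain phi z i <= 4 * i%:R * M ^+ 2.
  case: i i1 => // -[|i] _; first by rewrite gain1 lexx !mulr_ge0.
  rewrite gainS//; have /andP[-> /le_trans->]// := L i.+1 isT.
  by rewrite ler_wpM2r ?exprn_ge0// ler_wpM2l// ler_nat.
have S : 0 <= z i * \sum_(i <= j < n) phi i j * z j <= 4 * i%:R * M ^+ 2.
  have ii : (1 <= i <= i)%N by rewrite i1/=.
  have /andP[S0 S1] := coag_sum_le ii (mass_le_tail n i1).
  rewrite mulr_ge0//= (@le_trans _ _ (M * (4 * M)))//.
    by rewrite ler_pM// mass_le_coord.
  rewrite mulrCA -expr2 ler_wpM2r ?exprn_ge0//.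
  by rewrite ler_peMr// ler1n.
have {L}/andP[l0 l1] := L i i1; case/andP: G => g0 g1; case/andP: S => s0 s1.
have -> : 12 * i%:R * M ^+ 2 = 3 * (4 * i%:R * M ^+ 2) by ring.
by rewrite /flow ler_norml; apply/andP; split; lra.
Qed.

End mass_bounds.

Lemma trunc_rhs_flow (R : realType) (phi : nat -> nat -> R) (z : nat -> R)
    (n i : nat) : (1 <= i < n)%N -> trunc_rhs n phi z i = flow phi z n.+1 i.
Proof.
move=> /andP[i1 iltn]; rewrite /trunc_rhs /flow; case: eqP => [->|_].
  by rewrite gain1 /loss big_nat1 mul1r; ring.
by rewrite ltn_eqF.
Qed.

(** Summation by parts through [gainS]. The last size has neither loss nor coagulation, so both sums
    on the right stop before [n]. *)
Lemma trunc_moment (R : realType) (phi : nat -> nat -> R) (z g : nat -> R)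
    (n : nat) : (2 <= n)%N ->
  \sum_(1 <= i < n.+1) g i * trunc_rhs n phi z i =
  \sum_(1 <= i < n) (g i.+1 - g i) * loss phi z i -
  \sum_(1 <= i < n) g i * (z i * \sum_(i <= j < n.+1) phi i j * z j).
Proof.
move=> n2; have n1 : (1 <= n)%N by exact: ltnW.
have gainsum : \sum_(1 <= i < n.+1) g i * gain phi z i =
    \sum_(1 <= i < n) g i.+1 * loss phi z i.
  rewrite big_ltn// gain1 mulr0 add0r big_add1/= !big_nat.
  by apply: eq_bigr => i /andP[i1 _]; rewrite gainS.
rewrite big_nat_recr//= {2}/trunc_rhs eqxx gtn_eqF//.
transitivity (\sum_(1 <= i < n.+1) g i * gain phi z i -
    \sum_(1 <= i < n) g i * loss phi z i -
    \sum_(1 <= i < n) g i * (z i * \sum_(i <= j < n.+1) phi i j * z j)).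
  rewrite [in RHS]big_nat_recr//= [in RHS]addrAC -2![in RHS]addrA.
  rewrite addrC [in RHS]addrCA; congr (_ + _).
  rewrite -opprD -big_split -sumrB/= !big_nat; apply: eq_bigr => i iP.
  by rewrite trunc_rhs_flow// /flow; ring.
by rewrite gainsum -sumrB; congr (_ - _); apply: eq_bigr => i _; rewrite mulrBl.
Qed.

(* The loss and coagulation terms differ only in the order of summation, up to
   the interactions with the last component. *)
Lemma trunc_mass_rhs_le0 (R : realType) (phi : nat -> nat -> R) (z : nat -> R)
    (n : nat) : kernel_nonneg phi -> kernel_sym phi -> (forall i, 0 <= z i) ->
  (2 <= n)%N -> \sum_(1 <= i < n.+1) i%:R * trunc_rhs n phi z i <= 0.
Proof.
move=> phi0 phiS z0 n2; rewrite (@trunc_moment _ _ _ (fun i => i%:R))//.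
under eq_bigr do rewrite -natrB// subSnn mul1r.
rewrite subr_le0.
apply: (@le_trans _ _ (\sum_(1 <= i < n) \sum_(i <= j < n)
    i%:R * (z i * (phi i j * z j)))); last first.
  rewrite !big_nat; apply: ler_sum => i /andP[i1 iltn].
  rewrite -mulr_sumr -mulr_sumr ler_wpM2l// ler_wpM2l//.
  rewrite [leRHS]big_nat_recr ?(ltnW iltn)//= lerDl mulr_ge0// phi0//.
  exact: leq_trans i1 (ltnW iltn).
rewrite /loss.
under eq_bigr do rewrite mulr_sumr.
pose F i j := z i * (j%:R * phi i j * z j).
rewrite [leLHS](_ : _ =
    \sum_(1 <= i < n) \sum_(1 <= j < n | (j <= i)%N) F i j); last first.
  rewrite !big_nat; apply: eq_bigr => i /andP[i1 iltn].
  by rewrite (big_nat_widen _ _ n)//; apply: eq_bigl => j; rewrite ltnS.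
rewrite (exchange_big_dep_nat xpredT)//= le_eqVlt; apply/orP; left; apply/eqP.
rewrite !big_nat; apply: eq_bigr => i /andP[i1 iltn].
rewrite [in RHS](big_nat_widenl _ 1)//= [RHS]big_nat_cond [LHS]big_nat_cond.
apply: eq_big => [j|j /andP[/andP[j1 _] _]] //.
by rewrite /F (phiS j i)//; ring.
Qed.

(** The coagulation sum has a favourable sign and is dropped. By [loss_le] the loss is at most 4 M i
    z_i, and the growth condition on [g], a discrete form of x g'(x) <= C g(x), absorbs the factor
    i. *)
Lemma trunc_moment_rhs_le (R : realType) (phi : nat -> nat -> R)
    (z g : nat -> R) (M C : R) (n : nat) :
  kernel_nonneg phi -> kernel_linear phi -> mass_le M z ->
  (forall i, 0 <= g i <= g i.+1) ->
  (forall i, (1 <= i)%N -> i%:R * (g i.+1 - g i) <= C * g i) ->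
  (2 <= n)%N ->
  \sum_(1 <= i < n.+1) g i * trunc_rhs n phi z i <=
  4 * M * C * \sum_(1 <= i < n.+1) g i * z i.
Proof.
move=> phi0 phiL zM g0 gC n2; have [z0 _] := zM; have M0 := mass_ge0 zM.
have C0 i : (1 <= i)%N -> 0 <= C * g i.
  move=> i1; apply: le_trans (gC i i1); rewrite mulr_ge0// subr_ge0.
  by case/andP: (g0 i).
rewrite trunc_moment// mulr_sumr lerBlDr.
apply: (@le_trans _ _ (\sum_(1 <= i < n) 4 * M * C * (g i * z i))).
  rewrite !big_nat; apply: ler_sum => i /andP[i1 iltn].
  apply: (@le_trans _ _ ((g i.+1 - g i) * (4 * M * (i%:R * z i)))).
    rewrite ler_wpM2l ?(loss_le phiL zM)// subr_ge0.
    by case/andP: (g0 i).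
  rewrite [leLHS](_ : _ = 4 * M * z i * (i%:R * (g i.+1 - g i))); last by ring.
  rewrite [leRHS](_ : _ = 4 * M * z i * (C * g i)); last by ring.
  by rewrite ler_wpM2l ?gC// !mulr_ge0.
have n1 : (1 <= n)%N by exact: ltnW.
(* The top term [i = n], which completes the moment, and the dropped coagulation sum are both
   non-negative. *)
rewrite (big_nat_recr n)//= -addrA lerDl addr_ge0//.
  rewrite (_ : _ * _ = 4 * M * z n * (C * g n)); last by ring.
  by apply: mulr_ge0; [rewrite !mulr_ge0|exact: C0].
rewrite big_nat sumr_ge0// => i /andP[i1 _].
have /andP[gi0 _] := g0 i; rewrite !mulr_ge0// big_nat sumr_ge0// => j.
by case/andP=> ij _; rewrite mulr_ge0// phi0// (leq_trans i1).
Qed.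

(* A superlinear weight below N with slope 1 above N: [cutoff_growth] holds with
   a constant independent of N, while [cutoff_moment_small] makes the initial
   moment small, so a single Gronwall estimate bounds the tails of the mass. *)
Definition cutoff (R : realType) (N i : nat) : R :=
  i%:R * ((minn i N)%:R / N%:R).

Lemma cutoff_homo (R : realType) (N i : nat) :
  0 <= cutoff R N i <= cutoff R N i.+1.
Proof.
apply/andP; split; first by rewrite !mulr_ge0// invr_ge0.
rewrite ler_pM ?ler_nat// ?divr_ge0// ler_wpM2r ?invr_ge0// ler_nat.
by rewrite leq_min geq_minr andbT (leq_trans (geq_minl _ _)).
Qed.

(** Below N the weight is i^2/N, and i((i+1)^2 - i^2) = 2 i^2 + i <= 3 i^2; from N on it is i, with
    increment 1. *)
Lemma cutoff_growth (R : realType) (N i : nat) : (1 <= N)%N -> (1 <= i)%N ->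
  i%:R * (cutoff R N i.+1 - cutoff R N i) <= 3 * cutoff R N i.
Proof.
move=> N1 i1; have N0 : (0 : R) < N%:R by rewrite ltr0n.
rewrite /cutoff; have [iN|Ni] := ltnP i N.
  rewrite (minn_idPl iN).
  rewrite !mulrA -!mulrBl mulrA ler_pM2r ?invr_gt0//.
  have : (1 : R) <= i%:R by rewrite ler1n.
  by rewrite -natr1; nra.
rewrite (minn_idPr (leqW Ni)) divff ?gt_eqF// !mulr1.
rewrite -natr1 addrAC subrr add0r mulr1.
by rewrite ler_peMl// ?ler1n//; lra.
Qed.

Lemma cutoff_ge (R : realType) (N i : nat) : (1 <= N)%N -> (N <= i)%N ->
  cutoff R N i = i%:R.
Proof.
by move=> N1 Ni; rewrite /cutoff (minn_idPr Ni) divff ?mulr1// pnatr_eq0 -lt0n.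
Qed.

(** * Tightness of the initial datum *)

Lemma Bplus_tight (R : realType) (z : nat -> R) : Bplus z ->
  exists M, (forall n, \sum_(1 <= i < n) i%:R * z i <= M) /\
    forall e, 0 < e -> exists P : nat,
      (1 <= P)%N /\ forall n, \sum_(P <= i < n) i%:R * z i <= e.
Proof.
move=> [zfin z0]; pose S n := \sum_(1 <= i < n) i%:R * z i.
have iz0 i : (1 <= i)%N -> 0 <= i%:R * z i by move=> /z0 ?; rewrite mulr_ge0.
have S_homo : {homo S : m n / (m <= n)%N >-> m <= n}.
  move=> m n mn; rewrite /S; have [m0|m1] := leqP m 1.
    by rewrite big_geq// big_nat sumr_ge0// => i /andP[/iz0].
  rewrite [leRHS](big_cat_nat (ltnW m1) mn)/= lerDl big_nat sumr_ge0// => i.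
  by case/andP=> mi _; apply: iz0; exact: leq_trans (ltnW m1) mi.
have Sfin n : S n <= fine (normB z).
  rewrite -lee_fin fineK; last first.
    by rewrite ge0_fin_numE ?nneseries_ge0// => i _ _; rewrite lee_fin mulr_ge0.
  rewrite -sumEFin big_nat.
  under eq_bigr => i /andP[i1 _] do rewrite -[z i]ger0_norm ?z0//.
  rewrite -big_nat; apply: nneseries_lim_ge => i _ _.
  by rewrite lee_fin mulr_ge0.
have Ssup : has_sup (range S).
  split; first by exists (S 0%N), 0%N.
  by exists (fine (normB z)) => _ [n _ <-]; exact: Sfin.
have Sle n : S n <= sup (range S) by apply: sup_upper_bound => //; exists n.
exists (sup (range S)); split=> // e e0.
have [_ [P _ <-] SP] := sup_adherent e0 Ssup.
(* The successor secures a starting index at least 1; partial sums being nondecreasing, it keeps the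
   supremum within e. *)
exists P.+1; split=> // n; have [nP|/ltnW Pn] := leqP n P.+1.
  by rewrite big_geq// ltW.
have := Sle n; rewrite {1}/S (@big_cat_nat _ _ _ P.+1)//= -/(S P.+1).
by have := S_homo _ _ (leqnSn P); lra.
Qed.

(** Split at an index P beyond which the mass is at most e/2. Below P the weight is at most i P/N,
    contributing at most P M/N; above P it is at most i. *)
Lemma cutoff_moment_small (R : realType) (z : nat -> R) (e : R) :
  Bplus z -> 0 < e -> exists N : nat, (1 <= N)%N /\
    forall n, \sum_(1 <= i < n) cutoff R N i * z i <= e.
Proof.
move=> zB e0; have [M [zM /(_ (e / 2))[|P [P1 Ptail]]]] := Bplus_tight zB.
  by rewrite divr_gt0.
have z0 := zB.2; have M0 : 0 <= M by apply: le_trans (zM 0%N); rewrite big_geq.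
(* The condition [x <= N%:R] amounts to P M/N <= e/2. *)
pose x := P%:R * M / (e / 2).
have x0 : 0 <= x by rewrite !divr_ge0 ?mulr_ge0// ltW.
pose N := (Num.bound x).+1; have xN : x <= N%:R.
  by rewrite (le_trans (ltW (archi_boundP x0)))// ler_nat.
have N0 : (0 : R) < N%:R by rewrite ltr0n.
exists N; split=> // n.
apply: (@le_trans _ _ (\sum_(1 <= i < n)
    (P%:R / N%:R * (i%:R * z i) + if (P <= i)%N then i%:R * z i else 0))).
  rewrite !big_nat; apply: ler_sum => i /andP[i1 _].
  have zi := z0 _ i1; have izi : 0 <= i%:R * z i by rewrite mulr_ge0.
  have [Pi|iP] := leqP P i.
    rewrite (@le_trans _ _ (i%:R * z i))//; last first.
      by rewrite lerDr !mulr_ge0// invr_ge0.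
    rewrite /cutoff ler_wpM2r// ler_piMr// ler_pdivrMr// mul1r ler_nat.
    exact: geq_minr.
  rewrite addr0 /cutoff mulrAC mulrC ler_wpM2r// ler_wpM2r ?invr_ge0// ler_nat.
  by rewrite (leq_trans (geq_minl _ _))// ltnW.
have tailE : \sum_(1 <= i < n) (if (P <= i)%N then i%:R * z i else 0) =
    \sum_(P <= i < n) i%:R * z i.
  by rewrite [RHS](big_nat_widenl _ 1)// [RHS]big_mkcond.
rewrite big_split/= -mulr_sumr tailE (splitr e) lerD//.
apply: (@le_trans _ _ (P%:R / N%:R * M)); first by rewrite ler_wpM2l ?divr_ge0.
by rewrite mulrAC ler_pdivrMr// [leRHS]mulrC -ler_pdivrMr// divr_gt0.
Qed.

(** * Uniform estimates for the truncated solutions *)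

(** Setting the unconstrained components to 0 makes sign and mass conditions meaningful at every
    index, including 0. *)
Definition restrict (R : realType) (n : nat) (z : nat -> R) (i : nat) : R :=
  if (1 <= i <= n)%N then z i else 0.

Lemma restrict_in (R : realType) (n : nat) (z : nat -> R) (i : nat) :
  (1 <= i <= n)%N -> restrict n z i = z i.
Proof. by rewrite /restrict => ->. Qed.

Lemma trunc_rhs_restrict (R : realType) (phi : nat -> nat -> R) (z : nat -> R)
    (n i : nat) : (1 <= i <= n)%N ->
  trunc_rhs n phi (restrict n z) i = trunc_rhs n phi z i.
Proof.
move=> /andP[i1 iltn].
have S f a b : (1 <= a)%N -> (b <= n)%N ->
    \sum_(a <= j < b.+1) f j * restrict n z j = \sum_(a <= j < b.+1) f j * z j.
  move=> a1 bn; rewrite !big_nat; apply: eq_bigr => j /andP[aj jb].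
  by rewrite restrict_in// (leq_trans a1 aj) (leq_trans _ bn).
have gainE k : (k <= n)%N -> gain phi (restrict n z) k = gain phi z k.
  case: k => [|[|k]] kn; rewrite /gain/= ?mul0r//.
  by rewrite restrict_in ?(ltnW kn)//= S// ltnW.
rewrite /trunc_rhs !gainE// /loss !restrict_in ?i1 ?(leq_trans i1 iltn)//.
by rewrite !S//.
Qed.

Lemma is_trunc_solution_restrict (R : realType) (n : nat)
    (phi : nat -> nat -> R) (c0 : nat -> R) (c : R -> nat -> R) :
  is_trunc_solution n phi c0 c ->
  is_trunc_solution n phi c0 (fun t => restrict n (c t)).
Proof.
move=> [c_ge0 c_init c_ode]; split=> [i t i1 t0|i i1|i t i1 t0].
- by rewrite restrict_in// c_ge0.
- by rewrite restrict_in// c_init.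
- rewrite trunc_rhs_restrict//.
  have -> : (fun s => restrict n (c s) i) = (fun s => c s i).
    by apply/funext => s; rewrite restrict_in.
  exact: c_ode.
Qed.

Lemma trunc_moment_derive (R : realType) (n : nat)
    (phi : nat -> nat -> R) (c0 g : nat -> R) (c : R -> nat -> R) (t : R) :
  is_trunc_solution n phi c0 c -> 0 <= t ->
  is_derive_within [set s | 0 <= s]
    (fun s => \sum_(1 <= i < n.+1) g i * c s i) t
    (\sum_(1 <= i < n.+1) g i * trunc_rhs n phi (c t) i).
Proof.
move=> [_ _ c_ode] t0; rewrite big_nat.
have -> : (fun s => \sum_(1 <= i < n.+1) g i * c s i) =
    (fun s => \sum_(1 <= i < n.+1 | (1 <= i < n.+1)%N) g i * c s i).
  by apply/funext => s; rewrite big_nat.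
by apply: is_derive_within_sum => i /andP[i1 iltn]; apply: c_ode; rewrite ?i1.
Qed.

(* The n-th member solves the truncated system of size n + 2 and vanishes
   outside the sizes 1, ..., n + 2. The equation for the last size has another
   form, hence the restriction i <= n in [approx_MVT]. *)
Record approx_family (R : realType) (phi : nat -> nat -> R) (c0 : nat -> R)
    (M : R) (y : nat -> R -> nat -> R) : Prop := ApproxFamily {
  approx_mass : forall n t, 0 <= t -> mass_le M (y n t);
  approx_tail : forall T e : R, 0 < e -> exists N : nat, (1 <= N)%N /\
    forall n m t, 0 <= t <= T -> \sum_(N <= i < m) i%:R * y n t i <= e;
  approx_MVT : forall (n i : nat) (s t : R), (1 <= i <= n)%N -> 0 <= s ->
    s < t -> exists2 u, s < u < t &
      y n t i - y n s i = flow phi (y n u) n.+3 i * (t - s);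
  approx_init : forall n i : nat, (1 <= i <= n)%N -> y n 0 i = c0 i
}.

Lemma trunc_approx_family (R : realType) (phi : nat -> nat -> R)
    (c0 : nat -> R) (cn : nat -> R -> nat -> R) :
  Bplus c0 -> kernel_nonneg phi -> kernel_sym phi -> kernel_linear phi ->
  (forall n : nat, (2 <= n)%N -> is_trunc_solution n phi c0 (cn n)) ->
  exists M, approx_family phi c0 M (fun n t => restrict n.+2 (cn n.+2 t)).
Proof.
move=> c0B phi0 phiS phiL hcn; have [M [c0M _]] := Bplus_tight c0B.
exists M; set y := fun n t => _.
have ysol n : is_trunc_solution n.+2 phi c0 (y n).
  exact/is_trunc_solution_restrict/hcn.
have yge0 n t i : 0 <= t -> 0 <= y n t i.
  move=> t0; rewrite /y /restrict; case: ifP => // i1.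
  by rewrite (trunc_nonneg (hcn _ _)).
(* Sizes beyond n + 2 carry nothing, so a sum with any upper limit is bounded by the full truncated
   sum, whose derivative is known. *)
have ysum n t g m k : 0 <= t -> (forall i, (k <= i)%N -> 0 <= g i) ->
    \sum_(k <= i < m) g i * y n t i <= \sum_(k <= i < n.+3) g i * y n t i.
  move=> t0 g0; have yn i : (n.+3 <= i)%N -> g i * y n t i = 0.
    by move=> ni; rewrite /y /restrict [(i <= _)%N]leqNgt ni andbF mulr0.
  pose K := maxn m n.+3.
  rewrite (big_nat_widen _ _ K) ?leq_maxl//.
  rewrite [leRHS](big_nat_widen _ _ K) ?leq_maxr//=.
  rewrite big_mkcond [leRHS]big_mkcond !big_nat.
  apply: ler_sum => i /andP[ki _].
  have gy : 0 <= g i * y n t i by rewrite mulr_ge0 ?g0 ?yge0.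
  by have [ni|ni] := ltnP i n.+3; case: ifP => // _; rewrite yn.
have ymass n t : 0 <= t -> mass_le M (y n t).
  move=> t0; split=> [i|m]; first exact: yge0.
  apply: le_trans (ysum _ _ (fun i => i%:R) _ _ t0 _) _ => //.
  have := @gronwall_within _ _ _ 0 t (fun u u0 =>
    trunc_moment_derive (g := fun i => i%:R) (ysol n) u0).
  rewrite mul0r expR0 mul1r => /(_ _ t0) le0.
  apply: le_trans (le0 _) _ => [u u0|].
    by rewrite mul0r trunc_mass_rhs_le0// => i; exact: yge0.
  apply: le_trans (c0M n.+3); rewrite le_eqVlt !big_nat; apply/orP; left.
  by apply/eqP/eq_bigr => i iP; rewrite (trunc_init (ysol n)).
split=> [//|T e e0|n i s t /andP[i1 iltn] s0 st|n i /andP[i1 iltn]].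
(* The factor 4 M comes from [loss_le] and 3 from [cutoff_growth]. Dividing e by exp(L T) offsets
   the Gronwall growth up to time T. *)
- pose L := 4 * M * 3.
  have [|N [N1 Nc0]] := @cutoff_moment_small _ _ (e / expR (L * T)) c0B.
    by rewrite divr_gt0// expR_gt0.
  exists N; split=> // n m t /andP[t0 tT].
  apply: le_trans (ysum _ _ (fun i => i%:R) _ _ t0 _) _ => //.
  have cge0 i : 0 <= cutoff R N i * y n t i.
    by have /andP[? _] := cutoff_homo R N i; rewrite mulr_ge0// yge0.
  (* The weight equals i from N on, so the mass tail is part of the cutoff moment. *)
  apply: (@le_trans _ _ (\sum_(1 <= i < n.+3) cutoff R N i * y n t i)).
    rewrite (big_nat_widenl _ 1)// big_mkcond; apply: ler_sum => i _ /=.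
    by case: ifP => // Ni; rewrite cutoff_ge.
  apply: le_trans (gronwall_within (L := L) (fun u u0 =>
    trunc_moment_derive (g := cutoff R N) (ysol n) u0) _ t0) _ => [u u0|].
    apply: trunc_moment_rhs_le => //; first exact: ymass.
      exact: cutoff_homo.
    by move=> i i1; exact: cutoff_growth.
  have M0 := mass_ge0 (ymass 0%N 0 (lexx _)).
  rewrite mulrC -ler_pdivlMr ?expR_gt0//.
  rewrite !big_nat; under eq_bigr => i iP do rewrite (trunc_init (ysol n))//.
  rewrite -big_nat (le_trans (Nc0 n.+3))// ler_pM2l//.
  by rewrite lef_pV2 ?posrE ?expR_gt0// ler_expR ler_wpM2l// !mulr_ge0.
- have iP : (1 <= i <= n.+2)%N by rewrite i1 leqW// leqW.
  have [u ut ->] := MVT_within (fun u u0 => trunc_ode (ysol n) iP u0) s0 st.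
  by exists u => //; rewrite trunc_rhs_flow// i1 ltnS leqW.
- by rewrite (trunc_init (ysol n))// i1 leqW// leqW.
Qed.

(** * Passage to the limit *)

(** By compactness of [a, b] the image filter has a cluster point, and an ultrafilter converges to
    each of its cluster points. *)
Lemma ultra_cvg_bounded (R : realType) (I : Type) (U : set_system I)
    (x : I -> R) (a b : R) : UltraFilter U ->
  (\forall n \near U, a <= x n <= b) -> cvg (x n @[n --> U]).
Proof.
move=> UU xab.
have [|p [pab Up]] := @segment_compact R a b (x @ U) _.
  by apply: filterS xab => n; rewrite /= in_itv.
apply/cvg_ex; exists p => A pA.
have [//|UA] := in_ultra_setVsetC (x @^-1` A) UU.
have [//|q [nAq Aq]] := Up (~` A) A _ pA.
by have := nAq Aq.
Qed.

Lemma sum_cvg (R : realType) (I : Type) (F : set_system I) (w : I -> nat -> R)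
    (z a : nat -> R) (m n : nat) : Filter F -> (1 <= m)%N ->
  (forall i, (1 <= i)%N -> w x i @[x --> F] --> z i) ->
  \sum_(m <= j < n) a j * w x j @[x --> F] --> \sum_(m <= j < n) a j * z j.
Proof.
move=> FF m1 wz; rewrite big_nat.
have -> : (fun x => \sum_(m <= j < n) a j * w x j) =
    (fun x => \sum_(m <= j < n | (m <= j < n)%N) a j * w x j).
  by apply/funext => s; rewrite big_nat.
apply: cvg_big => [|j /andP[mj _]]; first exact: add_continuous.
by apply: cvgM; [exact: cvg_cst|apply: wz; exact: leq_trans mj].
Qed.

Lemma weighted_sum_le_limit (R : realType) (I : Type) (F : set_system I)
    (w : I -> nat -> R) (z a : nat -> R) (e : R) (m n : nat) :
  ProperFilter F -> (1 <= m)%N ->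
  (forall i, (1 <= i)%N -> w x i @[x --> F] --> z i) ->
  (\forall x \near F, \sum_(m <= j < n) a j * w x j <= e) ->
  \sum_(m <= j < n) a j * z j <= e.
Proof.
move=> FF m1 wz we.
exact: (cvgr_to_le (@sum_cvg _ _ _ w z a m n _ m1 wz)).
Qed.

(** Only finite sums are involved, so bounds pass to coordinatewise limits. Convergence says nothing
    about index 0, hence the condition there. *)
Lemma mass_le_limit (R : realType) (I : Type) (F : set_system I)
    (w : I -> nat -> R) (z : nat -> R) (M : R) :
  ProperFilter F -> z 0%N = 0 ->
  (forall i, (1 <= i)%N -> w x i @[x --> F] --> z i) ->
  (\forall x \near F, mass_le M (w x)) -> mass_le M z.
Proof.
move=> FF z0 wz wM; split=> [[|i]|n]; first by rewrite z0.
  by apply: (cvgr_to_ge (wz i.+1 isT)); apply: filterS wM => x [].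
apply: (weighted_sum_le_limit _ _ wz) => //.
by apply: filterS wM => x [].
Qed.

(** [fine] would send an infinite series to 0; [coag_fin] excludes this for states of bounded
    mass. *)
Definition coag (R : realType) (phi : nat -> nat -> R) (z : nat -> R)
    (i : nat) : R :=
  fine (\sum_(i <= j <oo) (phi i j * z j)%:E)%E.

Definition full_flow (R : realType) (phi : nat -> nat -> R) (z : nat -> R)
    (i : nat) : R :=
  gain phi z i - loss phi z i - z i * coag phi z i.

Section coag_series.
Context (R : realType) (phi : nat -> nat -> R) (M : R).
Hypotheses (phi0 : kernel_nonneg phi) (phiS : kernel_sym phi).
Hypotheses (phiL : kernel_linear phi).

Lemma nneseries_le_partial (u : nat -> R) (i : nat) (b : R) :
  (forall j, (i <= j)%N -> 0 <= u j) ->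
  (forall n, \sum_(i <= j < n) u j <= b) ->
  (\sum_(i <= j <oo) (u j)%:E <= b%:E)%E.
Proof.
move=> u0 ub; apply: lime_le.
  by apply: is_cvg_nneseries => n ni _; rewrite lee_fin u0.
by apply: nearW => n; rewrite sumEFin lee_fin.
Qed.

(** Past N the kernel is at most 4 j, so the remainder of the series is at most four times the mass
    tail; the same bound gives finiteness. *)
Lemma coag_tail (z : nat -> R) (i N : nat) (e : R) :
  mass_le M z -> (1 <= i <= N)%N ->
  (forall n, \sum_(N <= j < n) j%:R * z j <= e) ->
  (\sum_(i <= j <oo) (phi i j * z j)%:E)%E = (coag phi z i)%:E /\
  0 <= coag phi z i - \sum_(i <= j < N) phi i j * z j <= 4 * e.
Proof.
move=> zM iN ze; have /andP[i1 iN'] := iN; have [z0 _] := zM.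
have e0 : 0 <= e by apply: le_trans (ze 0%N); rewrite big_geq.
have u0 j : (i <= j)%N -> 0 <= phi i j * z j.
  by move=> ij; rewrite mulr_ge0// phi0// (leq_trans i1).
have sum_le n : \sum_(i <= j < n) phi i j * z j <=
    \sum_(i <= j < N) phi i j * z j + 4 * e.
  have /andP[t0 t1] := coag_sum_le phi0 phiS phiL zM iN (ze n).
  have [nN|/ltnW Nn] := leqP n N.
    rewrite -[leLHS]addr0 lerD ?mulr_ge0//.
    have [ni|/ltnW ni] := leqP n i.
      by rewrite big_geq// big_nat sumr_ge0// => j /andP[/u0].
    rewrite [leRHS](big_cat_nat ni nN)/= lerDl big_nat sumr_ge0// => j.
    by case/andP => nj _; apply: u0; exact: leq_trans nj.
  by rewrite (big_cat_nat iN' Nn)/= lerD2l.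
have S_le := nneseries_le_partial u0 sum_le.
have S_ge : ((\sum_(i <= j < N) phi i j * z j)%:E <=
    \sum_(i <= j <oo) (phi i j * z j)%:E)%E.
  by rewrite -sumEFin; apply: nneseries_lim_ge => j ij _; rewrite lee_fin u0.
have S_fin : (\sum_(i <= j <oo) (phi i j * z j)%:E)%E \is a fin_num.
  rewrite ge0_fin_numE; first exact: le_lt_trans S_le (ltry _).
  by apply: nneseries_ge0 => j ij _; rewrite lee_fin u0.
rewrite /coag; split; first by rewrite fineK.
by move: S_le S_ge; rewrite -(fineK S_fin) !lee_fin subr_ge0 lerBlDl => -> ->.
Qed.

Lemma coag_fin (z : nat -> R) (i : nat) : mass_le M z -> (1 <= i)%N ->
  (\sum_(i <= j <oo) (phi i j * z j)%:E)%E = (coag phi z i)%:E.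
Proof.
move=> zM i1; have [||-> //] := @coag_tail z i i M zM; first by rewrite i1/=.
by move=> n; exact: mass_le_tail zM _ _ i1.
Qed.

(** Gain and loss are finite sums; the coagulation series is cut at N, with uniformly small
    remainders. The filter is arbitrary in order to cover both convergence at a fixed time and joint
    convergence in truncation and time. *)
Lemma flow_cvg (I : Type) (F : set_system I) (w : I -> nat -> R)
    (k : I -> nat) (z : nat -> R) (i : nat) : ProperFilter F -> (1 <= i)%N ->
  mass_le M z ->
  (\forall x \near F, mass_le M (w x)) ->
  (forall N, \forall x \near F, (N <= k x)%N) ->
  (forall e : R, 0 < e -> exists N : nat, (1 <= N)%N /\
    \forall x \near F, forall m, \sum_(N <= j < m) j%:R * w x j <= e) ->
  (forall j, (1 <= j)%N -> w x j @[x --> F] --> z j) ->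
  flow phi (w x) (k x) i @[x --> F] --> full_flow phi z i.
Proof.
move=> FF i1 zM wM kF wtail wz.
have loss_cvg j : (1 <= j)%N -> loss phi (w x) j @[x --> F] --> loss phi z j.
  by move=> j1; apply: cvgM; [exact: wz|exact: sum_cvg].
have gain_cvg : gain phi (w x) i @[x --> F] --> gain phi z i.
  case: i i1 => // -[|j] _.
    rewrite gain1; have -> : (fun x => gain phi (w x) 1) = cst 0.
      by apply/funext => x; rewrite gain1.
    exact: cvg_cst.
  rewrite gainS//; have -> : (fun x => gain phi (w x) j.+2) =
      (fun x => loss phi (w x) j.+1) by apply/funext => x; rewrite gainS.
  exact: loss_cvg.
apply: cvgB; first by apply: cvgB => //; exact: loss_cvg.
apply: cvgM; first exact: wz.
apply/cvgrPdist_le => e e0.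
(* Both remainders then lie in [0, e/2], because 4 (e/8) = e/2, so their difference costs at most
   e/2; the heads differ by at most e/4. *)
have [|N0 [N01 wN0]] := wtail (e / 8); first by rewrite divr_gt0.
pose N := maxn N0 i; have iN : (1 <= i <= N)%N by rewrite i1 leq_maxr.
have N1 : (1 <= N)%N by rewrite (leq_trans i1) ?leq_maxr.
have wN : \forall x \near F, forall m, \sum_(N <= j < m) j%:R * w x j <= e / 8.
  near=> x => m; have [x0 _] : mass_le M (w x) by near: x.
  have : \sum_(N0 <= j < m) j%:R * w x j <= e / 8.
    by move: m; near: x.
  apply: le_trans; rewrite (big_nat_widenl _ N0) ?leq_maxl// big_mkcond.
  by apply: ler_sum => j _ /=; case: ifP => // _; rewrite mulr_ge0.
have zN m : \sum_(N <= j < m) j%:R * z j <= e / 8.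
  by apply: (weighted_sum_le_limit _ N1 wz); apply: filterS wN => x.
have [_ /andP[z1 z2]] := coag_tail zM iN zN.
have := @sum_cvg _ _ _ w z (phi i) i N FF i1 wz.
move=> /cvgrPdist_le/(_ (e / 4)); rewrite divr_gt0// => /(_ isT) wd.
near=> x.
have xM : mass_le M (w x) by near: x.
have xk : (N <= k x)%N by near: x.
have xN m : \sum_(N <= j < m) j%:R * w x j <= e / 8 by move: m; near: x.
have xd : `|\sum_(i <= j < N) phi i j * z j -
    \sum_(i <= j < N) phi i j * w x j| <= e / 4.
  by near: x.
have /andP[x1 x2] := coag_sum_le phi0 phiS phiL xM iN (xN (k x)).
have /andP[_ iN'] := iN; rewrite (big_cat_nat iN' xk)/=.
by move: xd; rewrite !ler_norml => /andP[? ?]; apply/andP; split; lra.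
Unshelve. all: by end_near. Qed.

End coag_series.

Section limit_of_approximations.
Context (R : realType) (phi : nat -> nat -> R) (c0 : nat -> R) (M : R).
Context (y : nat -> R -> nat -> R).
Hypotheses (phi0 : kernel_nonneg phi) (phiS : kernel_sym phi).
Hypotheses (phiL : kernel_linear phi) (yP : approx_family phi c0 M y).

(** Both orders of [s] and [t] are treated at once, and the intermediate time is located by its
    distance to [s], as two-sided neighbourhoods of [s] require. *)
Lemma approx_mean_value (n i : nat) (s t : R) : (1 <= i <= n)%N ->
  0 <= s -> 0 <= t -> s != t ->
  exists u, [/\ 0 <= u, `|u - s| <= `|t - s| &
    y n t i - y n s i = flow phi (y n u) n.+3 i * (t - s)].
Proof.
move=> i1 s0 t0; rewrite neq_lt => /orP[st|ts].
- have [u /andP[su ut] yE] := approx_MVT yP i1 s0 st.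
  exists u; split=> //; first exact: le_trans (ltW su).
  by rewrite !ger0_norm ?subr_ge0 ?(ltW st) ?(ltW su)// lerD2r ltW.
- have [u /andP[tu us] yE] := approx_MVT yP i1 t0 ts.
  exists u; split=> //; first exact: le_trans (ltW tu).
  + by rewrite !ler0_norm ?subr_le0 ?(ltW ts) ?(ltW us)// lerN2 lerD2r ltW.
  + by rewrite -opprB yE -mulrN opprB.
Qed.

Lemma approx_lipschitz (n i : nat) (s t : R) : (1 <= i <= n)%N ->
  0 <= s -> 0 <= t ->
  `|y n t i - y n s i| <= 12 * i%:R * M ^+ 2 * `|t - s|.
Proof.
move=> iP s0 t0; have [->|st] := eqVneq s t.
  by rewrite !subrr normr0 mulr0.
have [u [u0 _ ->]] := approx_mean_value iP s0 t0 st.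
have /andP[i1 _] := iP.
by rewrite normrM ler_wpM2r// (flow_bound phi0 phiS phiL (approx_mass yP n u0)).
Qed.

Lemma approx_limit : exists c : R -> nat -> R,
  [/\ forall t, 0 <= t -> mass_le M (c t),
    forall i, (1 <= i)%N -> c 0 i = c0 i,
    forall i (t : R), (1 <= i)%N -> 0 <= t ->
      is_derive_within [set s | 0 <= s] (fun s => c s i) t
        (full_flow phi (c t) i) &
    forall i (t : R), (1 <= i)%N -> 0 <= t ->
      full_flow phi (c s) i @[s --> within [set s | 0 <= s] (nbhs t)] -->
      full_flow phi (c t) i].
Proof.
have [U [UU ooU]] := ultraFilterLemma (F := \oo) _.
have Uge N : \forall n \near U, (N <= n)%N by apply: ooU; exact: nbhs_infty_ge.
(* The value 0 at index 0 is the one [mass_le_limit] asks for. *)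
pose c (t : R) (i : nat) : R :=
  if (1 <= i)%N then lim (y n t i @[n --> U]) else 0.
have cU (t : R) i : 0 <= t -> (1 <= i)%N -> y n t i @[n --> U] --> c t i.
  move=> t0 i1; rewrite /c i1; apply: (@ultra_cvg_bounded _ _ _ _ 0 M).
  apply: nearW => n; have ynM := approx_mass yP n t0.
  by rewrite ynM.1 (mass_le_coord ynM i1).
have cM (t : R) : 0 <= t -> mass_le M (c t).
  move=> t0; apply: (@mass_le_limit R _ U (fun n => y n t)) => //.
    by move=> i i1; exact: cU.
  by apply: nearW => n; exact: (approx_mass yP n t0).
have flowU (t : R) i : 0 <= t -> (1 <= i)%N ->
    flow phi (y n t) n.+3 i @[n --> U] --> full_flow phi (c t) i.
  move=> t0 i1.
  apply: (@flow_cvg R phi M phi0 phiS phiL _ U (fun n => y n t) (fun n => n.+3)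
    (c t) i _ i1 (cM t t0)).
  - by apply: nearW => n; exact: (approx_mass yP n t0).
  - by move=> N; apply: filterS (Uge N) => n Nn; rewrite !leqW.
  - move=> e e0; have [N [N1 yN]] := approx_tail yP t e0.
    by exists N; split=> //; apply: nearW => n m; apply: yN; rewrite t0/=.
  - by move=> j j1; exact: cU.
(* The maximum with 0 keeps times nonnegative while u ranges over a full
   neighbourhood of s. *)
have cvg_joint (s : R) j : 0 <= s -> (1 <= j)%N ->
    y p.1 (Num.max p.2 0) j @[p --> filter_prod U (nbhs s)] --> c s j.
  move=> s0 j1; apply/cvgrPdist_le => e e0.
  pose A := 12 * j%:R * M ^+ 2; have A0 : 0 <= A.
    by apply: mulr_ge0; rewrite ?sqr_ge0// mulr_ge0.
  have ns : \forall n \near U, `|c s j - y n s j| <= e / 2.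
    by apply: (cvgr_dist_le _ _ (cU s j s0 j1)); rewrite divr_gt0.
  (* With this radius the Lipschitz error is at most A e / (2 (A+1)) <= e/2; adding 1 keeps the
     denominator positive when A = 0. *)
  have q0 : 0 < e / (2 * (A + 1)) by rewrite divr_gt0// mulr_gt0// ltr_pwDr.
  have us : \forall u \near s, `|u - s| <= e / (2 * (A + 1)).
    by apply: filterS (near_dist_lt s q0) => u /ltW.
  exists ([set n | (j <= n)%N /\ `|c s j - y n s j| <= e / 2],
    [set u | `|u - s| <= e / (2 * (A + 1))]).
    by split; [exact: (filterI (Uge j) ns)|exact: us].
  move=> [n u] /= [[jn nse] use].
  have jP : (1 <= j <= n)%N by rewrite j1.
  have m0 : 0 <= Num.max u 0 by rewrite le_max lexx orbT.
  have max_le : `|Num.max u 0 - s| <= `|u - s|.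
    have [u0|u0] := leP 0 u; first by [].
    rewrite sub0r normrN ger0_norm// ltr0_norm; lra.
  have yL := approx_lipschitz jP s0 m0.
  rewrite -(subrKA (y n s j)) (le_trans (ler_normD _ _))// (splitr e) lerD//.
  rewrite distrC (le_trans yL)// -/A.
  apply: (@le_trans _ _ (A * (e / (2 * (A + 1))))).
    by rewrite ler_wpM2l// (le_trans max_le).
  rewrite invfM mulrA mulrA ler_pdivrMr ?ltr_pwDr//.
  by have := divr_ge0 (ltW e0) (ler0n R 2); nra.
(* One set of indices in [U] serves all times near [s]. This uniformity matters because the
   intermediate time of the mean value theorem varies with n. *)
have flow_joint (s : R) i e : 0 <= s -> (1 <= i)%N -> 0 < e ->
    exists2 d : R, 0 < d & \forall n \near U, forall u, 0 <= u ->
      `|u - s| < d -> `|full_flow phi (c s) i - flow phi (y n u) n.+3 i| <= e.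
  move=> s0 i1 e0.
  pose w (p : nat * R) := y p.1 (Num.max p.2 0).
  have m0 u : 0 <= Num.max u 0 :> R by rewrite le_max lexx orbT.
  have wc : flow phi (w p) p.1.+3 i @[p --> filter_prod U (nbhs s)] -->
      full_flow phi (c s) i.
    apply: (@flow_cvg R phi M phi0 phiS phiL _ _ w (fun p => p.1.+3) (c s) i _
      i1 (cM s s0)).
    - by apply: nearW => p; exact: (approx_mass yP p.1 (m0 _)).
    - move=> N; exists ([set n | (N <= n)%N], setT).
        by split=> //=; [exact: Uge|exact: filterT].
      by move=> [n u] /= [Nn _]; rewrite !leqW.
    (* Times within distance 1 of [s] stay below s + 1, a horizon on which the tails are uniformly
       small. *)
    - move=> r r0; have [N [N1 yN]] := approx_tail yP (s + 1) r0.
      exists N; split=> //; exists (setT, [set u | u <= s + 1]).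
        split=> /=; first exact: filterT.
        apply: filterS (near_dist_lt s ltr01) => u /=.
        by rewrite ltr_norml => /andP[]; lra.
      move=> [n u] /= [_ us] m; apply: yN; rewrite m0/= ge_max us/=.
      by rewrite addr_ge0.
    - by move=> j j1; exact: cvg_joint.
  have [[A B]/= [UA sB] AB] : \forall p \near filter_prod U (nbhs s),
      `|full_flow phi (c s) i - flow phi (w p) p.1.+3 i| <= e.
    exact: (cvgr_dist_le _ _ wc).
  have /nbhs_ballP[d /= d0 dB] := sB.
  exists d => //; apply: filterS UA => n An u u0 us.
  have /AB/= : (A `*` B) (n, u).
    by split=> //=; apply: dB; rewrite /ball/= distrC.
  by rewrite /w/= max_l.
exists c; split=> // [i i1|i t i1 t0|i t i1 t0].
- rewrite -(cvg_lim _ (cU 0 i (lexx _) i1))//.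
  apply: cvg_lim => //; apply: cvg_near_cst.
  by apply: filterS (Uge i) => n ni; rewrite (approx_init yP)// i1.
- apply/is_derive_withinP => e e0.
  have [d d0 nd] := flow_joint t i e t0 i1 e0.
  have : \forall s \near t, `|s - t| < d.
    exact: near_dist_lt.
  apply: filterS => s sd s0; have [->|st] := eqVneq t s.
    by rewrite !subrr mulr0 subrr normr0 mulr0.
  (* The increment inequality is proved for each [y n] with [s] fixed, then passes to the limit
     along [U]; the radius [d] depends on neither. *)
  apply: (cvgr_to_le (F := U) (f := fun n =>
    `|y n s i - y n t i - full_flow phi (c t) i * (s - t)|)).
    apply: cvg_norm; apply: cvgB; last exact: cvg_cst.
    by apply: cvgB; exact: cU.
  near=> n.
  have iP : (1 <= i <= n)%N by rewrite i1; near: n; exact: Uge.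
  have [u [u0 us ->]] := approx_mean_value iP t0 s0 st.
  rewrite -mulrBl normrM ler_wpM2r// distrC.
  have ud := le_lt_trans us sd.
  by move: u u0 {us} ud; near: n; exact: nd.
- apply/cvgrPdist_le => e e0.
  have [d d0 nd] := flow_joint t i e t0 i1 e0.
  have : \forall s \near t, 0 <= s ->
      `|full_flow phi (c t) i - full_flow phi (c s) i| <= e.
    have : \forall s \near t, `|s - t| < d.
      exact: near_dist_lt.
    apply: filterS => s sd s0.
    (* At the fixed time [s] the approximate flows converge by [flowU], so the uniform estimate
       becomes one between two values of the limit flow. *)
    apply: (cvgr_to_le (F := U) (f := fun n =>
      `|full_flow phi (c t) i - flow phi (y n s) n.+3 i|)).
      by apply: cvg_norm; apply: cvgB; [exact: cvg_cst|exact: flowU].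
    by apply: filterS nd => n; exact.
  by [].
Unshelve. all: by end_near. Qed.

End limit_of_approximations.

(** * The integral equation *)

Lemma time_dom_infty (R : realType) :
  time_dom (+oo%E : \bar R) = [set t : R | 0 <= t].
Proof.
by apply/seteqP; split=> [t [//]|t t0]; split=> //; rewrite ltry.
Qed.

(** The fundamental theorem of calculus, with interior differentiability and endpoint limits
    extracted from one-sided derivatives; t = 0 is degenerate and treated apart. *)
Lemma integral_derive_within (R : realType) (f df : R -> R) (t : R) :
  (forall s : R, 0 <= s -> is_derive_within [set u | 0 <= u] f s (df s)) ->
  (forall s : R, 0 <= s ->
    df u @[u --> within [set u | 0 <= u] (nbhs s)] --> df s) ->
  0 <= t ->
  (\int[@lebesgue_measure R]_(s in `[0%R, t]) (df s)%:E = (f t - f 0)%:E)%E.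
Proof.
move=> fdf dfc; rewrite le_eqVlt => /predU1P[<-|t0].
  by rewrite subrr set_itv1 integral_set1.
have fc (s : R) : 0 <= s ->
    f u @[u --> within [set u | 0 <= u] (nbhs s)] --> f s.
  by move=> s0; exact: is_derive_within_continuous (fdf s s0).
rewrite (@continuous_FTC2 R df f 0 t t0)//.
- apply/subspace_continuousP => s /=; rewrite in_itv/= => /andP[s0 st].
  apply: cvg_trans (dfc s s0); apply: cvg_app; apply: within_subset => v /=.
  by rewrite in_itv/= => /andP[].
- split.
  + move=> s; rewrite in_itv/= => /andP[s0 _].
    by have [] := is_derive_within_interior s0 (fdf s (ltW s0)).
  + apply: cvg_trans (fc 0 (lexx _)); apply: cvg_app.
    by apply: within_subset => v /= /ltW.
  + apply: cvg_trans (fc t (ltW t0)); apply: cvg_app => A /= At.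
    have tn : \forall s \near t, 0 <= s.
      apply: filterS (near_dist_lt t t0) => s.
      by rewrite ltr_norml => /andP[]; lra.
    by apply: filterS (filterI tn At) => s [s0 As] _; exact: As.
- move=> s; rewrite in_itv/= => /andP[s0 _].
  have [_ dfs] := is_derive_within_interior s0 (fdf s (ltW s0)).
  by rewrite derive1E.
Qed.

Lemma is_solution_of_full_flow (R : realType) (phi : nat -> nat -> R)
    (c0 : nat -> R) (M : R) (c : R -> nat -> R) :
  kernel_nonneg phi -> kernel_sym phi -> kernel_linear phi ->
  (forall t : R, 0 <= t -> mass_le M (c t)) ->
  (forall i, (1 <= i)%N -> c 0 i = c0 i) ->
  (forall i (t : R), (1 <= i)%N -> 0 <= t ->
    is_derive_within [set s | 0 <= s] (fun s => c s i) t
      (full_flow phi (c t) i)) ->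
  (forall i (t : R), (1 <= i)%N -> 0 <= t ->
    full_flow phi (c s) i @[s --> within [set s | 0 <= s] (nbhs t)] -->
    full_flow phi (c t) i) ->
  is_solution phi c0 +oo%E c.
Proof.
move=> phi0 phiS phiL cM c_init c_der flow_cont.
have normB_le (t : R) : 0 <= t -> (normB (c t) <= M%:E)%E.
  move=> t0; apply: nneseries_le_partial => [j _|n]; first by rewrite mulr_ge0.
  under eq_bigr do rewrite ger0_norm ?(cM t t0).1//.
  exact: (cM t t0).2.
have c_cont i (t : R) : (1 <= i)%N -> 0 <= t ->
    {within `[0, t], continuous (fun s => c s i)}.
  move=> i1 t0; apply/subspace_continuousP => s /=.
  rewrite in_itv/= => /andP[s0 st].
  apply: cvg_trans (is_derive_within_continuous (c_der i s i1 s0)).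
  by apply: cvg_app; apply: within_subset => v /=; rewrite in_itv/= => /andP[].
split=> [t|i i1||i t i1|//|i t i1]; rewrite ?time_dom_infty/=.
- move=> t0; split; first exact: le_lt_trans (normB_le t t0) (ltry _).
  by move=> i _; exact: (cM t t0).1.
- apply/subspace_continuousP => t /= t0.
  exact: is_derive_within_continuous (c_der i t i1 t0).
- apply: (@le_lt_trans _ _ M%:E); last exact: ltry.
  by apply: ge_ereal_sup => _ [t t0 <-]; exact: normB_le.
- move=> t0.
  (* Here j may be smaller than i, so the kernel is bounded by 2(i+j) <= 4 i j, and the mass bound
     makes the series at most 4 i M at every time. *)
  apply: (@le_lt_trans _ _ (\int[@lebesgue_measure R]_(h in `[0%R, t])
      (4 * i%:R * M)%:E)%E); last first.
    rewrite integral_cst//= lebesgue_measure_itv/= lte_fin.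
    by case: ifP => _; rewrite ?mule0 ?ltry// -EFinB -EFinM ltry.
  have phic0 h j : 0 <= h -> (1 <= j)%N -> 0 <= phi i j * c h j.
    by move=> h0 j1; rewrite mulr_ge0 ?phi0//; exact: (cM h h0).1.
  apply: ge0_le_integral => //.
  + move=> h /=; rewrite in_itv/= => /andP[h0 _].
    by apply: nneseries_ge0 => j j1 _; rewrite lee_fin phic0.
  + have -> : (fun h => \sum_(1 <= j <oo) (phi i j * c h j)%:E)%E =
        (fun h => \sum_(0 <= j <oo | j \in [pred j | (1 <= j)%N])
          (phi i j * c h j)%:E)%E.
      by apply/funext => h; rewrite eseries_cond.
    apply: ge0_emeasurable_sum => [j h|j] /=; rewrite ?in_itv/=.
      by move=> /andP[h0 _] j1; rewrite lee_fin phic0.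
    move=> j1; apply/measurable_EFinP; apply: measurable_funM => //.
    by apply: subspace_continuous_measurable_fun => //; exact: c_cont.
  + move=> h /=; rewrite in_itv/= => /andP[h0 _].
    apply: nneseries_le_partial => [j|n]; first exact: phic0.
    apply: (@le_trans _ _ (\sum_(1 <= j < n) 4 * i%:R * (j%:R * c h j))).
      rewrite !big_nat; apply: ler_sum => j /andP[j1 _].
      rewrite mulrA ler_wpM2r ?(cM h h0).1//.
      apply: le_trans (phiL _ _ i1 j1) _; rewrite -!natrM ler_nat.
      rewrite (_ : 4 = 2 * 2)%N// -!mulnA leq_mul2l/= mul2n -addnn.
      by rewrite leq_add ?leq_pmulr ?leq_pmull.
    by rewrite -mulr_sumr ler_wpM2l ?mulr_ge0//; exact: (cM h h0).2.
- move=> t0.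
  (* On [0, t] the series is finite, so the extended-real integrand is the real number [full_flow],
     that is, the derivative of c_i. *)
  under eq_integral => h.
    rewrite inE/= in_itv/= => /andP[h0 _].
    rewrite (coag_fin phi0 phiS phiL (cM h h0) i1) -EFinM -!EFinB.
    over.
  rewrite (integral_derive_within (f := fun s => c s i))//.
  + by rewrite -EFinD addrC subrK.
  + by move=> s s0; exact: c_der.
  + by move=> s s0; exact: flow_cont.
Qed.

Theorem theorem1 (R : realType) (phi : nat -> nat -> R) (c0 : nat -> R)
    (cn : nat -> R -> nat -> R)
    (hc0 : Bplus c0)
    (hphi_nonneg : kernel_nonneg phi)
    (hphi_sym : kernel_sym phi)
    (hphi_bound : kernel_bound1 phi \/ kernel_bound2 phi \/ kernel_bound3 phi)
    (hcn : forall n : nat, (2 <= n)%N -> is_trunc_solution n phi c0 (cn n)) :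
  exists c : R -> nat -> R, is_solution phi c0 +oo%E c.
Proof.
have phiL := kernel_bounds_linear hphi_bound.
have [M yP] := trunc_approx_family hc0 hphi_nonneg hphi_sym phiL hcn.
have [c [cM c_init c_der flow_cont]] :=
  approx_limit hphi_nonneg hphi_sym phiL yP.
by exists c; exact: (is_solution_of_full_flow (M := M)).
Qed.
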